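(* Every inverse quantal frame is modular, but not every modular quantal frame is an inverse quantal frame.
   Context: An involutive quantale is a sup-lattice (complete lattice) $Q$ with an associative multiplication preserving arbitrary joins in each variable and a join-preserving involution $a\mapsto a^*$ with $a^{**}=a$, $(ab)^*=b^*a^*$; it is unital if the multiplication has a unit $e$. $1$ denotes the top element. A unital involutive quantale $Q$ is modular if $ab\wedge c\le a(b\wedge a^*c)$ for all $a,b,c\in Q$. A modular quantal frame is a modular (unital involutive) quantale whose underlying lattice is a frame. A support on a unital involutive quantale $Q$ is a join-preserving map $\varsigma:Q\to Q$ such that $\varsigma(a)\le e$, $\varsigma(a)\le aa^*$ and $a\le\varsigma(a)a$ for all $a\in Q$; it is stable if $\varsigma(ab)=\varsigma(a\varsigma(b))$ for all $a,b\in Q$. A stable quantal frame is a unital involutive quantale that has a stable support and whose underlying lattice is a frame. An inverse quantal frame is a stable quantal frame $Q$ such that $\bigvee\{s\in Q\mid ss^*\vee s^*s\le e\}=1$. *)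

(* Defs.v *)
From HB Require Import structures.
From mathcomp Require Import all_boot all_order.
From mathcomp Require Import boolp classical_sets.

Set Implicit Arguments.
Unset Strict Implicit.
Unset Printing Implicit Defensive.

Import Order.TTheory.

Declare Scope quantale_scope.
Delimit Scope quantale_scope with Q.
Local Open Scope classical_set_scope.
Local Open Scope group_scope.
Local Open Scope order_scope.
Local Open Scope quantale_scope.

(* The involution is the operation [inv] of [starMonoidType], which is an
   involutive antiautomorphism, not an inverse for the multiplication. *)
Notation "a ^*" := (inv a) : quantale_scope.

(* The lattice operations are determined by the order, so extending a bounded
   lattice by arbitrary suprema gives exactly a complete lattice.
   The unit of the multiplication is [1%g] and the top element is [\top]. *)
HB.mixin Record isUnitalInvolutiveQuantale (d : Order.disp_t) Q
    of Order.TBLattice d Q & StarMonoid Q := {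
  qsup : set Q -> Q;
  qsupP : forall A : set Q, supremums A (qsup A);
  mulg_qsupr : forall (a : Q) (A : set Q),
    a * qsup A = qsup [set a * b | b in A];
  mulg_qsupl : forall (A : set Q) (b : Q),
    qsup A * b = qsup [set a * b | a in A];
  invg_qsup : forall A : set Q, (qsup A)^* = qsup [set a^* | a in A]
}.

#[short(type="unitalInvolutiveQuantaleType")]
HB.structure Definition UnitalInvolutiveQuantale (d : Order.disp_t) :=
  { Q of isUnitalInvolutiveQuantale d Q & Order.TBLattice d Q & StarMonoid Q }.

Definition is_modular (d : Order.disp_t)
    (Q : unitalInvolutiveQuantaleType d) : Prop :=
  forall a b c : Q, (a * b) `&` c <= a * (b `&` (a^* * c)).

Definition is_frame (d : Order.disp_t)
    (Q : unitalInvolutiveQuantaleType d) : Prop :=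
  forall (a : Q) (A : set Q), a `&` qsup A = qsup [set a `&` b | b in A].

Definition is_modular_quantal_frame (d : Order.disp_t)
    (Q : unitalInvolutiveQuantaleType d) : Prop :=
  is_modular Q /\ is_frame Q.

Definition is_support (d : Order.disp_t)
    (Q : unitalInvolutiveQuantaleType d) (f : Q -> Q) : Prop :=
  [/\ forall A : set Q, f (qsup A) = qsup [set f a | a in A],
      forall a : Q, f a <= 1%g,
      forall a : Q, f a <= a * a^* &
      forall a : Q, a <= f a * a].

Definition is_stable_support (d : Order.disp_t)
    (Q : unitalInvolutiveQuantaleType d) (f : Q -> Q) : Prop :=
  is_support f /\ forall a b : Q, f (a * b) = f (a * f b).

Definition is_stable_quantal_frame (d : Order.disp_t)
    (Q : unitalInvolutiveQuantaleType d) : Prop :=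
  (exists f : Q -> Q, is_stable_support f) /\ is_frame Q.

Definition partial_units (d : Order.disp_t)
    (Q : unitalInvolutiveQuantaleType d) : set Q :=
  [set s : Q | (s * s^*) `|` (s^* * s) <= 1%g].

Definition is_inverse_quantal_frame (d : Order.disp_t)
    (Q : unitalInvolutiveQuantaleType d) : Prop :=
  is_stable_quantal_frame Q /\ qsup (@partial_units d Q) = \top.

(* Main.v *)
From HB Require Import structures.
Require Import Defs.
From mathcomp Require Import all_boot all_order.
From mathcomp Require Import boolp classical_sets.

(** Inverse implies modular.  If [s] is a partial unit, a stable support gives
    [x <= s s^* x] for every [x <= s b], because stability makes
    [f (s b) <= f s <= s s^*].  Taking [x = s b /\ c] and using [s^* s <= 1]
    yields [s b /\ c <= s (b /\ s^* c)], which is the modular law for partial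
    units ([partial_unit_modular]).  In an inverse quantal frame the partial
    units join to the top and are closed downwards, so the frame law writes
    every [a] as the join of the partial units below it
    ([sup_partial_units_below]).  Both [a b] and the meet with [c] preserve this
    join, so the law for the partial units below [a] gives the law for [a].

    Modular does not imply inverse.  Take the three-element chain
    [0 < e < T] with trivial involution, unit [e] and [T T = T], that is, [a b]
    is the larger of [a] and [b] unless one of them is [0].  It is a frame, being
    a finite chain, and it is modular: there is something to check only if
    [a = T] and [b], [c] are nonzero, and then [T (b /\ T c)] is [T], because
    [b] and [T c] are nonzero elements of a chain, so that their meet is nonzero.
    But [T T^* = T], so the partial units are [0] and [e], whose join is [e],
    not [T]. *)

Set Implicit Arguments.
Unset Strict Implicit.
Unset Printing Implicit Defensive.

Import Order.TTheory.

Local Open Scope classical_set_scope.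
Local Open Scope group_scope.
Local Open Scope order_scope.
Local Open Scope quantale_scope.

Section QuantaleTheory.
Context {d : Order.disp_t} {Q : unitalInvolutiveQuantaleType d}.
Implicit Types (a b c s x y : Q) (A : set Q).

Lemma qsup_ub A x : A x -> x <= qsup A.
Proof. by move=> Ax; case: (qsupP A) => + _; apply. Qed.

Lemma qsup_le A y : (forall x, A x -> x <= y) -> qsup A <= y.
Proof. by move=> Ay; case: (qsupP A) => _; apply. Qed.

Lemma homo_of_qsup (f : Q -> Q) :
  (forall A, f (qsup A) = qsup [set f a | a in A]) -> {homo f : x y / x <= y}.
Proof.
move=> fsup x y xy.
(* [y] is the join of [x] and [y], hence so is [f y] of [f x] and [f y]. *)
have -> : y = qsup [set x; y].
  apply/le_anti/andP; split; first by apply: qsup_ub; right.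
  by apply: qsup_le => _ [->|->].
by rewrite fsup; apply: qsup_ub; exists x; first left.
Qed.

Lemma le_mulgr a : {homo (fun b => a * b) : x y / x <= y}.
Proof. exact: homo_of_qsup (mulg_qsupr a). Qed.

Lemma le_mulgl b : {homo (fun a => a * b) : x y / x <= y}.
Proof. exact: homo_of_qsup (fun A => mulg_qsupl A b). Qed.

Lemma le_mulg a a' b b' : a <= a' -> b <= b' -> a * b <= a' * b'.
Proof. by move=> aa' bb'; exact: le_trans (le_mulgl b aa') (le_mulgr a' bb'). Qed.

Lemma le_invg : {homo (fun a => a^*) : x y / x <= y}.
Proof. exact: homo_of_qsup invg_qsup. Qed.

Lemma partial_unitsP s :
  partial_units s <-> s * s^* <= 1%g /\ s^* * s <= 1%g.
Proof. by rewrite /partial_units /= leUx; split=> /andP. Qed.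

Lemma partial_units_down x s : x <= s -> partial_units s -> partial_units x.
Proof.
move=> xs /partial_unitsP[s1 s2]; have xs' := le_invg xs.
by apply/partial_unitsP; split; [apply: le_trans s1|apply: le_trans s2];
   exact: le_mulg.
Qed.

Lemma sup_partial_units_below a :
  is_inverse_quantal_frame Q ->
  a = qsup [set a `&` s | s in @partial_units d Q].
Proof. by case=> -[_ frameQ] top; rewrite -frameQ top meetx1. Qed.

(** The support of [s b] is bounded by that of [s]: stability replaces [b] by
    its support, which lies below the unit. *)
Lemma support_mul_le (f : Q -> Q) s b :
  is_stable_support f -> f (s * b) <= f s.
Proof.
case=> -[fsup f1 _ _] stable; rewrite stable.
by apply: (homo_of_qsup fsup); rewrite -[leRHS]mulg1; exact: le_mulgr.
Qed.

(** In the quantale of relations, [s s^*] contains the identity of the domain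
    of [s], and anything below [s b] lives over that domain. *)
Lemma le_mul_invg_mul (f : Q -> Q) s b x :
  is_stable_support f -> x <= s * b -> x <= s * (s^* * x).
Proof.
move=> stf xsb; have [[fsup _ fl fr] _] := stf.
apply: le_trans (fr x) _; rewrite mulgA; apply: le_mulgl.
apply: le_trans (fl s); apply: le_trans (support_mul_le s b stf).
exact: homo_of_qsup fsup _ _ xsb.
Qed.

Lemma partial_unit_modular (f : Q -> Q) s b c :
  is_stable_support f -> partial_units s ->
  (s * b) `&` c <= s * (b `&` (s^* * c)).
Proof.
move=> stf /partial_unitsP[_ s1].
apply: le_trans (le_mul_invg_mul stf (leIl (s * b) c)) _.
apply: le_mulgr; rewrite lexI; apply/andP; split; last exact/le_mulgr/leIr.
apply: le_trans (le_mulgr _ (leIl _ _)) _.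
by rewrite mulgA -[leRHS]mul1g; exact: le_mulgl.
Qed.

Lemma inverse_quantal_frame_modular :
  is_inverse_quantal_frame Q -> is_modular Q.
Proof.
move=> invQ a b c; have [[[f stf] frameQ] _] := invQ.
rewrite {1}(sup_partial_units_below a invQ) mulg_qsupl meetC frameQ.
apply: qsup_le => _ [_ [_ [s pus <-] <-] <-]; rewrite meetC.
have puas := partial_units_down (leIr s a) pus.
apply: le_trans (partial_unit_modular b c stf puas) _.
apply: le_mulg; first exact: leIl.
by apply: leI2 => //; apply/le_mulgl/le_invg/leIl.
Qed.

End QuantaleTheory.

Definition chain3 := 'I_3.

HB.instance Definition _ := Order.FinTotal.copy chain3 'I_3.
HB.instance Definition _ := Order.hasBottom.Build _ chain3
  (@leq0n : forall x : chain3, ord0 <= x).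
HB.instance Definition _ := Order.hasTop.Build _ chain3
  (@leq_ord 2 : forall x : chain3, x <= ord_max).

Definition chain3_unit : chain3 := @Ordinal 3 1 isT.

Definition chain3_mul (a b : chain3) : chain3 :=
  if (a == \bot) || (b == \bot) then \bot else Order.max a b.

Lemma chain3_mulC : commutative chain3_mul.
Proof. by move=> a b; rewrite /chain3_mul orbC maxC. Qed.

Lemma chain3_mulA : associative chain3_mul.
Proof.
by move=> [[|[|[|a]]] ?] [[|[|[|b]]] ?] [[|[|[|c]]] ?] //; exact: val_inj.
Qed.

Lemma chain3_mul1 : left_id chain3_unit chain3_mul.
Proof. by move=> [[|[|[|a]]] ?] //; exact: val_inj. Qed.

Lemma chain3_mul_homo a : {homo chain3_mul a : x y / x <= y}.
Proof. by case: a => [[|[|[|a]]] ?] [[|[|[|b]]] ?] [[|[|[|c]]] ?]. Qed.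

HB.instance Definition _ := isStarMonoid.Build chain3
  chain3_mulA chain3_mul1 (fun=> erefl) chain3_mulC.

Definition chain3_sup (A : set chain3) : chain3 := \join_(x | `[< A x >]) x.

Lemma chain3_supP A : supremums A (chain3_sup A).
Proof.
split=> [x Ax|y Ay]; first by apply: joins_sup; exact/asboolP.
by apply/joinsP => x /asboolP; exact: Ay.
Qed.

(** A join in a finite chain is attained unless it is the empty join, so a
    monotone map that fixes the bottom preserves all joins. *)
Lemma chain3_sup_homo (f : chain3 -> chain3) A :
  {homo f : x y / x <= y} -> f \bot = \bot ->
  f (chain3_sup A) = chain3_sup [set f x | x in A].
Proof.
move=> fhomo f0; have [Aub _] := chain3_supP A.
apply/le_anti/andP; split; last first.
  have [_ ] := chain3_supP [set f x | x in A]; apply=> _ [x Ax <-].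
  exact/fhomo/Aub.
have [->|Asup] : chain3_sup A = \bot \/ A (chain3_sup A).
- rewrite /chain3_sup.
  elim/big_ind: _ => [|x y|]; [by left| |].
    by rewrite joinEtotal /Order.max; case: ifP.
  by move=> x /asboolP; right.
- by rewrite f0 le0x.
have [+ _] := chain3_supP [set f x | x in A]; apply; exact: imageP.
Qed.

Lemma chain3_mul_supr a A :
  chain3_mul a (chain3_sup A) = chain3_sup [set chain3_mul a b | b in A].
Proof.
apply: chain3_sup_homo; first exact: chain3_mul_homo.
by rewrite /chain3_mul eqxx orbT.
Qed.

Lemma chain3_mul_supl A b :
  chain3_mul (chain3_sup A) b = chain3_sup [set chain3_mul a b | a in A].
Proof.
rewrite chain3_mulC chain3_mul_supr; congr chain3_sup.
by apply: eq_imagel => a _; exact: chain3_mulC.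
Qed.

Lemma chain3_inv_sup A : chain3_sup A = chain3_sup [set a | a in A].
Proof. by rewrite image_id. Qed.

HB.instance Definition _ := isUnitalInvolutiveQuantale.Build _ chain3
  chain3_supP chain3_mul_supr chain3_mul_supl chain3_inv_sup.

Lemma chain3_modular : is_modular chain3.
Proof. by move=> [[|[|[|a]]] ?] [[|[|[|b]]] ?] [[|[|[|c]]] ?]. Qed.

Lemma chain3_frame : is_frame chain3.
Proof.
move=> a A; apply: (@chain3_sup_homo (fun b => a `&` b)); last exact: meetx0.
by move=> x y xy; exact: leI2.
Qed.

Lemma chain3_not_inverse : ~ is_inverse_quantal_frame chain3.
Proof.
case=> _ top.
have : qsup (@partial_units _ chain3) <= chain3_unit.
  by apply: qsup_le => -[[|[|[|x]]] ?].
by rewrite top.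
Qed.

Theorem theorem2p29 :
  (forall (d : Order.disp_t) (Q : unitalInvolutiveQuantaleType d),
     is_inverse_quantal_frame Q -> is_modular Q) /\
  ~ (forall (d : Order.disp_t) (Q : unitalInvolutiveQuantaleType d),
       is_modular_quantal_frame Q -> is_inverse_quantal_frame Q).
Proof.
split=> [d Q|modular_inverse]; first exact: inverse_quantal_frame_modular.
apply: chain3_not_inverse; apply: modular_inverse; split.
- exact: chain3_modular.
- exact: chain3_frame.
Qed.
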